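(* Let $f:\mathbb{R}^n\to\mathbb{R}\cup\{+\infty\}$, $g:\mathbb{R}^m\to\mathbb{R}\cup\{+\infty\}$, $A\in\mathbb{R}^{m\times n}$ and $\phi(x)\equiv f(x)+g(Ax)$ satisfy the standing assumptions (S1) and (S2) given in the context, and let $\alpha>0$, $r>0$. For $\rho>0$ consider the relaxed heavy ball ADMM (R-HB-ADMM) algorithm for the problem $\min_x\phi(x)$, with $\gamma\equiv1-r/\sqrt\rho$ and updates $$x_{k+1}=\operatorname{argmin}_{x\in\mathbb{R}^n}\Big\{\rho^{-1}f(x)+\tfrac12\|Ax-(\hat z_k-\hat u_k)\|^2\Big\},$$ $$z_{k+1}=\operatorname{argmin}_{z\in\mathbb{R}^m}\Big\{\rho^{-1}g(z)+\tfrac12\|z-(\alpha Ax_{k+1}+(1-\alpha)\hat z_k+\hat u_k)\|^2\Big\},$$ $$u_{k+1}=\hat u_k+\alpha Ax_{k+1}+(1-\alpha)\hat z_k-z_{k+1},$$ $$\hat u_{k+1}=u_{k+1}+\gamma(u_{k+1}-u_k),\qquad \hat z_{k+1}=z_{k+1}+\gamma(z_{k+1}-z_k),$$ initialized with $x_0\in\operatorname{dom}\phi$, $\hat z_0=z_0=Ax_0$, $\hat u_0=u_0=0$. Let $\epsilon\equiv\rho^{-1/2}$ and $t\equiv\epsilon k$ ($k=0,1,\dots$). Then in the limit $\epsilon\to0$ the algorithm reduces (in the sense given in the context) to the differential inclusion $$\alpha^{-1}A^TA\big[\ddot X(t)+r\dot X(t)\big]\in-\partial\phi(X(t)),\qquad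 X(0)=x_0,\quad\dot X(0)=0 .$$
   Context: For a function $h$ with effective domain $\operatorname{dom}h=\{x: h(x)<\infty\}$, the subdifferential at $x\in\operatorname{dom}h$ is $\partial h(x)=\{v: h(y)-h(x)\ge\langle v,y-x\rangle\ \forall y\in\operatorname{dom}h\}$. Standing assumptions. (S1) $f$ and $g$ are closed (closed epigraph) and convex, and $\phi=f+g\circ A$ has a finite global minimum; $A$ has full column rank, so $A^TA$ is invertible. The paper takes this to include that $f,g$ are proper and lower semicontinuous and $0\in\operatorname{int}(\operatorname{dom}g-A\operatorname{dom}f)$, so that $\partial\phi(x)=\partial f(x)+A^T\partial g(Ax)$. (S2) There are constants $c>0$, $L>0$ such that every $\xi\in\partial\phi(x)$ satisfies $\|\xi\|\le c(1+\|x\|)$, and $\langle\xi_y-\xi_x,y-x\rangle\le L\|y-x\|^2$ for all $x,y$ and all $\xi_x\in\partial\phi(x)$, $\xi_y\in\partial\phi(y)$. A solution of a second-order differential inclusion on $\mathcal I=[0,T]\subset\mathbb{R}_+$ is understood through its first-order form: $X$ and $\dot X$ are absolutely continuous and the inclusion holds for almost all $t\in\mathcal I$. Meaning of the limit. Iterates are identified with points on the grid $t_k=\epsilon k$. It is assumed throughout that there are continuous functions $X,Z,U,\hat Z,\hat U$ of time with $x_k\approx X(t_k)$, $z_k\approx Z(t_k)$, $u_k\approx U(t_k)$, $\hat z_k\approx\hat Z(t_k)$, $\hat u_k\approx\hat U(t_k)$, the approximation becoming exact as $\epsilon\to0$, and that the standard finite-difference approximations $\dot X(t_k)=\pm(x_{k\pm1}-x_k)/\epsilon+O(\epsilon)$,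 $\ddot X(t_k)=(x_{k+1}-2x_k+x_{k-1})/\epsilon^2+O(\epsilon)$ (and similarly for the other variables) may be used. That the algorithm ''reduces to'' a differential inclusion means that, in the limit $\epsilon\to0$, the function $X$ is a solution of that inclusion with the stated initial condition(s). *)

(* Defs.v *)
From HB Require Import structures.
From mathcomp Require Export all_boot all_order all_algebra.
From mathcomp Require Export all_classical all_reals all_analysis.

Set Implicit Arguments.
Unset Strict Implicit.
Unset Printing Implicit Defensive.

Import Order.TTheory GRing.Theory Num.Theory.
Import numFieldNormedType.Exports.

Local Open Scope classical_set_scope.
Local Open Scope ring_scope.

Section Euclidean.
Variables (R : realType) (d : nat).
Implicit Types u v : 'cV[R]_d.

Definition dotp u v : R := \sum_i u i 0 * v i 0.

(* The norm `|u| that MathComp-Analysis puts on matrices is the sup norm. *)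
Definition norm2 u : R := Num.sqrt (dotp u u).

End Euclidean.

Section ConvexAnalysis.
Variables (R : realType) (d : nat).
Implicit Types h : 'cV[R]_d -> \bar R.

Definition dom h : set 'cV[R]_d := [set x | (h x < +oo)%E].

Definition never_ninfty h : Prop := forall x, h x != -oo%E.

Definition proper h : Prop := never_ninfty h /\ dom h !=set0.

Definition closed_epigraph h : Prop :=
  closed [set p : 'cV[R]_d * R | (h p.1 <= p.2%:E)%E].

(* For h with values in R `|` {+oo}; at the endpoints of [0, 1] the convention
   0 * +oo = 0 makes the inequality trivial. *)
Definition convex_fun h : Prop :=
  forall (x y : 'cV[R]_d) (s : R), 0 <= s <= 1 ->
    (h (s *: x + (1 - s) *: y)%R <= s%:E * h x + (1 - s)%R%:E * h y)%E.

Definition subdiff h (x : 'cV[R]_d) : set 'cV[R]_d :=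
  [set v | dom h x /\
    forall y, dom h y -> ((dotp v (y - x)%R)%:E <= h y - h x)%E].

Definition argmin h : set 'cV[R]_d := [set x | forall y, (h x <= h y)%E].

Definition has_finite_minimum h : Prop :=
  exists2 x, argmin h x & h x \is a fin_num.

End ConvexAnalysis.

Section Assumptions.
Variables (R : realType) (n m : nat).
Variables (f : 'cV[R]_n -> \bar R) (g : 'cV[R]_m -> \bar R) (A : 'M[R]_(m, n)).

Definition objective : 'cV[R]_n -> \bar R := fun x => (f x + g (A *m x)%R)%E.

(* Closed, proper and lower semicontinuous are all listed although, for
   functions that never take the value -oo, a closed epigraph is the same as
   lower semicontinuity. *)
Record assumption_S1 : Prop := AssumptionS1 {
  S1_proper_f : proper f;
  S1_proper_g : proper g;
  S1_closed_f : closed_epigraph f;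
  S1_closed_g : closed_epigraph g;
  S1_lsc_f : lower_semicontinuous f;
  S1_lsc_g : lower_semicontinuous g;
  S1_convex_f : convex_fun f;
  S1_convex_g : convex_fun g;
  S1_minimum : has_finite_minimum objective;
  S1_full_column_rank : \rank A = n;
  S1_qualification :
    interior [set w - A *m x | w in dom g & x in dom f] 0
}.

Definition assumption_S2 : Prop :=
  exists c L : R, [/\ 0 < c, 0 < L,
    forall x xi, subdiff objective x xi -> norm2 xi <= c * (1 + norm2 x)
  & forall x y xi_x xi_y,
      subdiff objective x xi_x -> subdiff objective y xi_y ->
      dotp (xi_y - xi_x) (y - x) <= L * norm2 (y - x) ^+ 2].

End Assumptions.

Section Algorithm.
Variables (R : realType) (n m : nat).
Variables (f : 'cV[R]_n -> \bar R) (g : 'cV[R]_m -> \bar R) (A : 'M[R]_(m, n)).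
Variables (alpha r rho : R) (x0 : 'cV[R]_n).

(* The x- and z-updates have unique minimizers (A has full column rank), so
   that x_{k+1} = argmin {...} is the membership in the set of minimizers. *)
Record R_HB_ADMM (x : nat -> 'cV[R]_n) (z u zh uh : nat -> 'cV[R]_m) : Prop :=
  RHBADMM {
  admm_x : forall k, argmin (fun w : 'cV[R]_n =>
      (rho^-1)%R%:E * f w
      + (2^-1 * norm2 (A *m w - (zh k - uh k)) ^+ 2)%R%:E)%E (x k.+1);
  admm_z : forall k, argmin (fun w : 'cV[R]_m =>
      (rho^-1)%R%:E * g w
      + (2^-1 * norm2 (w - (alpha *: (A *m x k.+1) + (1 - alpha) *: zh k
                            + uh k)) ^+ 2)%R%:E)%E (z k.+1);
  admm_u : forall k,
      u k.+1 = uh k + alpha *: (A *m x k.+1) + (1 - alpha) *: zh k - z k.+1;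
  admm_uh : forall k,
      uh k.+1 = u k.+1 + (1 - r / Num.sqrt rho) *: (u k.+1 - u k);
  admm_zh : forall k,
      zh k.+1 = z k.+1 + (1 - r / Num.sqrt rho) *: (z k.+1 - z k);
  admm_x0 : x 0%N = x0;
  admm_z0 : z 0%N = A *m x0;
  admm_zh0 : zh 0%N = z 0%N;
  admm_u0 : u 0%N = 0;
  admm_uh0 : uh 0%N = u 0%N
}.

End Algorithm.

Section ContinuousTime.
Variables (R : realType) (d : nat).
Implicit Types (T t : R) (Y : R -> 'cV[R]_d) (y : R -> nat -> 'cV[R]_d).

(* Derivative relative to [0, T]: one-sided at 0 and at T. *)
Definition derivative_on T Y t (v : 'cV[R]_d) : Prop :=
  (s - t)^-1 *: (Y s - Y t) @[s --> within `[0, T] t^'] --> v.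

Definition absolutely_continuous_on T Y : Prop :=
  forall e : R, 0 < e -> exists2 delta : R, 0 < delta &
    forall s : seq (R * R),
      all (fun p => [&& 0 <= p.1, p.1 <= p.2 & p.2 <= T]) s ->
      pairwise (fun p q => (p.2 <= q.1) || (q.2 <= p.1)) s ->
      \sum_(p <- s) (p.2 - p.1) < delta ->
      \sum_(p <- s) norm2 (Y p.2 - Y p.1) < e.

Definition step (rho : R) : R := (Num.sqrt rho)^-1.

Definition grid_time (rho : R) (k : nat) : R := step rho * k%:R.

(* step rho tends to 0 as rho tends to +oo. A quantity attached to the grid
   points is O(step rho), resp. vanishes, at a fixed time t = t_k; the constant
   may depend on t. Every t >= 0 lies on the grids with rho = (k / t)^2. *)
Definition grid_vanishes t (err : R -> nat -> 'cV[R]_d) : Prop :=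
  forall e : R, 0 < e -> \forall rho \near +oo, forall k,
    grid_time rho k = t -> norm2 (err rho k) <= e.

Definition grid_bigO t (err : R -> nat -> 'cV[R]_d) : Prop :=
  exists C : R, \forall rho \near +oo, forall k,
    grid_time rho k = t -> norm2 (err rho k) <= C * step rho.

(* y rho k is the k-th iterate of the algorithm run with the parameter rho.
   Differences that would need a time outside [0, T] are left out. *)
Record continuous_limit T y Y : Prop := ContinuousLimit {
  limit_continuous : {within `[0, T], continuous Y};
  limit_exact : forall t, 0 <= t <= T ->
    grid_vanishes t (fun rho k => y rho k - Y t);
  limit_differences : exists Y1 Y2 : R -> 'cV[R]_d,
    [/\ forall t, 0 <= t <= T -> derivative_on T Y t (Y1 t),
        forall t, 0 < t < T -> derivative_on T Y1 t (Y2 t),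
        forall t, 0 <= t < T -> grid_bigO t (fun rho k =>
          (step rho)^-1 *: (y rho k.+1 - y rho k) - Y1 t),
        forall t, 0 < t <= T -> grid_bigO t (fun rho k =>
          (step rho)^-1 *: (y rho k - y rho k.-1) - Y1 t)
      & forall t, 0 < t < T -> grid_bigO t (fun rho k =>
          (step rho ^+ 2)^-1 *: (y rho k.+1 - 2 *: y rho k + y rho k.-1)
          - Y2 t)]
}.

End ContinuousTime.

Definition heavy_ball_solution (R : realType) (n m : nat)
    (f : 'cV[R]_n -> \bar R) (g : 'cV[R]_m -> \bar R) (A : 'M[R]_(m, n))
    (alpha r T : R) (x0 : 'cV[R]_n) (X : R -> 'cV[R]_n) : Prop :=
  exists V : R -> 'cV[R]_n,
    [/\ forall t, 0 <= t <= T -> derivative_on T X t (V t),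
        absolutely_continuous_on T X /\ absolutely_continuous_on T V,
        {ae (@lebesgue_measure R), forall t, 0 <= t <= T ->
          exists2 W : 'cV[R]_n, derivative_on T V t W &
            [set - xi | xi in subdiff (objective f g A) (X t)]
              (alpha^-1 *: (A^T *m A *m (W + r *: V t)))},
        X 0 = x0
      & V 0 = 0].

(* Main.v *)
(* Let p and q be the subgradients of f at x_{k+1} and of g at z_{k+1} given by
   the optimality conditions of the two minimizations; in particular
   q = rho u_{k+1}. Eliminating A x_{k+1} through the u-update writes p + A^T q
   as a combination of rho (z_{k+1} - zh_k) and rho (u_{k+1} - uh_k), which
   converge to Z'' + r Z' and U'' + r U' along the grids through a fixed time.
   With the qualification 0 in int (dom g - A dom f) the convergence of
   p + A^T q forces q to stay bounded, so U = 0; moreover Z = A X. Lower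
   semicontinuity then passes the subgradient inequality to the limit, which
   gives the inclusion on ]0, T[. By (S2) and the invertibility of A^T A,
   X'' + r X' is bounded, whence X and X' are Lipschitz on [0, T]. The
   comparison of x_1 with x_0 in the first minimization gives X'(0) = 0. *)
Require Import Defs.
From mathcomp Require Import ring lra.
Import Order.TTheory GRing.Theory Num.Theory.
Import numFieldNormedType.Exports.
Local Open Scope classical_set_scope.
Local Open Scope ring_scope.

Set Implicit Arguments.
Unset Strict Implicit.
Unset Printing Implicit Defensive.

(** * Euclidean products *)

Section Dotp.
Context {R : realType} {d : nat}.
Implicit Types (u v w : 'cV[R]_d) (a : R).

Lemma dotpC u v : dotp u v = dotp v u.
Proof. by apply: eq_bigr => i _; rewrite mulrC. Qed.

Lemma dotpDl u v w : dotp (u + v) w = dotp u w + dotp v w.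
Proof. by rewrite /dotp -big_split; apply: eq_bigr => i _; rewrite mxE mulrDl. Qed.

Lemma dotpZl a u v : dotp (a *: u) v = a * dotp u v.
Proof. by rewrite /dotp mulr_sumr; apply: eq_bigr => i _; rewrite mxE mulrA. Qed.

Lemma dotpDr u v w : dotp u (v + w) = dotp u v + dotp u w.
Proof. by rewrite !(dotpC u) dotpDl. Qed.

Lemma dotpZr a u v : dotp u (a *: v) = a * dotp u v.
Proof. by rewrite !(dotpC u) dotpZl. Qed.

Lemma dotpNl u v : dotp (- u) v = - dotp u v.
Proof. by rewrite -scaleN1r dotpZl mulN1r. Qed.

Lemma dotpNr u v : dotp u (- v) = - dotp u v.
Proof. by rewrite dotpC dotpNl dotpC. Qed.

Lemma dotpBr u v w : dotp u (v - w) = dotp u v - dotp u w.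
Proof. by rewrite dotpDr dotpNr. Qed.

Lemma dotp_ge0 u : 0 <= dotp u u.
Proof. by apply: sumr_ge0 => i _; rewrite -expr2 sqr_ge0. Qed.

Lemma norm2_sqr u : norm2 u ^+ 2 = dotp u u.
Proof. by rewrite sqr_sqrtr// dotp_ge0. Qed.

Lemma norm2_ge0 u : 0 <= norm2 u. Proof. exact: sqrtr_ge0. Qed.

Lemma coord_le_norm u (i : 'I_d) : `|u i 0| <= `|u|.
Proof.
rewrite [leRHS]mx_normrE.
exact: (le_bigmax _ (fun ij : 'I_d * 'I_1 => `|u ij.1 ij.2|) (i, 0)).
Qed.

Lemma norm_le_coord u a : 0 <= a -> (forall i, `|u i 0| <= a) -> `|u| <= a.
Proof.
move=> a0 ua; rewrite [leLHS]mx_normrE.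
by apply: bigmax_le => // -[i j] _ /=; rewrite (ord1 j).
Qed.

(** Limits refer to the sup norm, the assumptions to the Euclidean norm; this bound and
    [norm2_le_norm] allow passing from one to the other. *)
Lemma norm_le_norm2 u : `|u| <= norm2 u.
Proof.
apply: norm_le_coord => [|i]; first exact: norm2_ge0.
rewrite -sqrtr_sqr ler_wsqrtr// /dotp (bigD1 i)//= -expr2 lerDl.
by apply: sumr_ge0 => j _; rewrite -expr2 sqr_ge0.
Qed.

Lemma dotp_le u v : `|dotp u v| <= d%:R * (`|u| * `|v|).
Proof.
apply: le_trans (ler_norm_sum _ _ _) _.
rewrite -[X in X%:R]card_ord mulr_natl -sumr_const ler_sum// => i _.
by rewrite normrM ler_pM// coord_le_norm.
Qed.

(** A crude constant suffices: a sum of d squares is at most d [|u|]^2, hence at most (d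
    [|u|])^2. *)
Lemma norm2_le_norm u : norm2 u <= d%:R * `|u|.
Proof.
rewrite -(@ler_pXn2r _ 2)// ?nnegrE ?norm2_ge0 ?mulr_ge0//.
rewrite norm2_sqr exprMn (le_trans (ler_norm _))// (le_trans (dotp_le _ _))//.
rewrite -expr2 ler_wpM2r ?sqr_ge0//.
rewrite expr2 -natrM ler_nat; by case: (d) => // k; rewrite leq_pmulr.
Qed.

Lemma cvg_dotp (T : Type) (F : set_system T) (FF : Filter F)
    (f h : T -> 'cV[R]_d) u v :
  f x @[x --> F] --> u -> h x @[x --> F] --> v ->
  dotp (f x) (h x) @[x --> F] --> dotp u v.
Proof.
move=> fu hv; rewrite /dotp; apply: cvg_big => [|i _]; first exact: add_continuous.
apply: cvgM; [apply: (cvg_comp _ (fun w : 'cV[R]_d => w i 0) fu) |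
  apply: (cvg_comp _ (fun w : 'cV[R]_d => w i 0) hv)];
  exact: coord_continuous.
Qed.

End Dotp.

Lemma cvg_mx_coord {R : realType} (T : Type) (F : set_system T) {FF : Filter F}
    d (f : T -> 'cV[R]_d) (v : 'cV[R]_d) :
  (forall i, f x i 0 @[x --> F] --> v i 0) -> f x @[x --> F] --> v.
Proof.
move=> fv; apply/cvgrPdist_le => e e0.
have : \forall x \near F, forall i, `|v i 0 - f x i 0| <= e.
  by apply: filter_forall => i; have /cvgrPdist_le := fv i; apply.
apply: filterS => x vx; apply: norm_le_coord => [|i]; first exact: ltW.
by rewrite !mxE.
Qed.

Lemma cvg_mulmx {R : realType} {m n : nat} (A : 'M[R]_(m, n)) (T : Type)
    (F : set_system T) {FF : Filter F} (f : T -> 'cV[R]_n) (v : 'cV[R]_n) :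
  f x @[x --> F] --> v -> A *m f x @[x --> F] --> A *m v.
Proof.
move=> fv; apply: cvg_mx_coord => i; rewrite mxE.
under eq_fun do rewrite mxE.
apply: cvg_big => [|j _]; first exact: add_continuous.
apply: cvgM; first exact: cvg_cst.
apply: (cvg_comp _ (fun w : 'cV[R]_n => w j 0) fv); exact: coord_continuous.
Qed.

Lemma dotp_mulmx {R : realType} {m n : nat} (A : 'M[R]_(m, n)) u v :
  dotp (A^T *m u) v = dotp u (A *m v).
Proof.
have dE d (a b : 'cV[R]_d) : dotp a b = (a^T *m b) 0 0.
  by rewrite mxE; apply: eq_bigr => i _; rewrite mxE.
by rewrite !dE trmx_mul trmxK mulmxA.
Qed.

(** * Subgradients *)

Lemma le_of_le_small_slope {R : realType} (a b c : R) : 0 <= c ->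
  (forall s, 0 < s <= 1 -> a <= b + s * c) -> a <= b.
Proof.
move=> c0 abc; apply/ler_addgt0Pr => e e0.
have e'0 : 0 < e / (c + 1) by rewrite divr_gt0// ltr_wpDl.
have s0 : 0 < Num.min 1 (e / (c + 1)) by rewrite lt_min ltr01.
apply: (le_trans (abc (Num.min 1 (e / (c + 1))) _)).
  by rewrite s0 ge_min lexx.
rewrite lerD2l (@le_trans _ _ (e / (c + 1) * c))//.
  by rewrite ler_wpM2r// ge_min lexx orbT.
by rewrite mulrAC ler_pdivrMr ?ltr_wpDl// ler_pM2l// lerDl.
Qed.

Lemma dom_fin_num {R : realType} {d : nat} (h : 'cV[R]_d -> \bar R) x :
  never_ninfty h -> dom h x -> h x \is a fin_num.
Proof. by move=> hn dx; rewrite fin_numE hn lt_eqF. Qed.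

Lemma gt_real {R : realType} (a : \bar R) :
  a != -oo%E -> exists b : R, (b%:E < a)%E.
Proof.
case: a => [s||]// _; last by exists 0; rewrite ltry.
by exists (s - 1); rewrite lte_fin gtrBl.
Qed.

(** The minimizer x is compared with s y + (1 - s) x. By convexity of h and after division by s, the
    quadratic part contributes its derivative and an error s |B (y - x)|^2 / 2, which disappears as
    s tends to 0. The x-update is the case B = A, the z-update the case B = 1. *)
Lemma argmin_quadratic_subdiff {R : realType} {d k : nat}
    (h : 'cV[R]_d -> \bar R) (B : 'M[R]_(k, d)) (b : 'cV[R]_k) (rho : R) x :
  0 < rho -> proper h -> convex_fun h ->
  argmin (fun w => (rho^-1)%R%:E * h w
    + (2^-1 * norm2 (B *m w - b) ^+ 2)%R%:E)%E x ->
  subdiff h x (rho *: (B^T *m (b - B *m x))).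
Proof.
move=> rho0 [hn [y0 dy0]] cvx minx.
(* Otherwise the minimal value would be +oo, whereas the value at [y0] is finite. *)
have dx : dom h x.
  rewrite /dom /= ltey; apply/eqP => hx; have := minx y0.
  rewrite hx gt0_muley ?lte_fin ?invr_gt0// addye// leye_eq.
  by rewrite -(fineK (dom_fin_num hn dy0)).
split=> // y dy.
have hxE := fineK (dom_fin_num hn dx); have hyE := fineK (dom_fin_num hn dy).
move: (fine (h x)) (fine (h y)) hxE hyE => a c hxE hyE.
rewrite -hxE -hyE -EFinD lee_fin dotpZl dotp_mulmx.
rewrite -ler_pdivlMl//.
set v := B *m (y - x).
apply: (@le_of_le_small_slope _ _ _ (2^-1 * dotp v v)).
  by rewrite mulr_ge0 ?invr_ge0 ?dotp_ge0.
move=> s /andP[s0 s1].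
have s01 : 0 <= s <= 1 by rewrite ltW.
have hw := cvx y x s s01.
set w := (s *: y + (1 - s) *: x)%R in hw.
have dw : dom h w.
  by apply: le_lt_trans hw _; rewrite -hxE -hyE -!EFinM -EFinD ltry.
have := minx w.
move: hw; rewrite -hxE -hyE -!EFinM -(fineK (dom_fin_num hn dw)).
move: (fine (h w)) => e.
rewrite -!EFinM -!EFinD !lee_fin => hw.
have -> : B *m w - b = (B *m x - b) + s *: v.
  rewrite /w /v mulmxBr mulmxDr -!scalemxAr.
  by apply/matrixP => i j; rewrite !mxE; ring.
rewrite -[b - _]opprB dotpNl; move: (B *m x - b) => P0.
rewrite !norm2_sqr dotpDl !dotpDr !dotpZl !dotpZr (dotpC v P0).
move: (dotp _ _) (dotp v v) (dotp _ _) => P Q S H.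
have ri : 0 < rho^-1 by rewrite invr_gt0.
have H2 : rho^-1 * e <= rho^-1 * (s * c + (1 - s) * a) by rewrite ler_pM2l.
rewrite -(ler_pM2l s0); nra.
Qed.

Lemma lsc_near {R : realType} (V : topologicalType) (h : V -> \bar R)
    (x_ : nat -> V) x (a : R) :
  lower_semicontinuous h -> x_ @ \oo --> x -> (a%:E < h x)%E ->
  \forall j \near \oo, (a%:E < h (x_ j))%E.
Proof. by move=> hlsc xx /hlsc[W Wx Wh]; exact: filterS Wh (xx _ Wx). Qed.

(** * Limits of pairs of subgradients of f and g *)

Section SumRule.
Context {R : realType} {n m : nat}.
Variables (f : 'cV[R]_n -> \bar R) (g : 'cV[R]_m -> \bar R) (A : 'M[R]_(m, n)).
Hypotheses (fn : never_ninfty f) (gn : never_ninfty g).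

Lemma dom_objective y : dom (objective f g A) y -> dom f y /\ dom g (A *m y).
Proof.
rewrite /dom /objective /=; have := fn y; have := gn (A *m y).
by case: (f y) (g (A *m y)) => [?||] [?||]//= _ _; rewrite !ltry.
Qed.

(** This is the sum of the two subgradient inequalities, with <q, d - z> split through A y and A x.
    The choice d = A y leads to the subgradient inequality for the objective; a free difference d -
    A y tests the size of q. *)
Lemma subdiff_pair_ineq x z p q y d :
  subdiff f x p -> subdiff g z q -> dom f y -> dom g d ->
  fine (f x) + fine (g z) + dotp (p + A^T *m q) (y - x)
    + dotp q (d - A *m y) + dotp q (A *m x - z) <= fine (f y) + fine (g d).
Proof.
move=> [dx +] [dz +] dy dd => /(_ _ dy) + /(_ _ dd).
rewrite -(fineK (dom_fin_num fn dx)) -(fineK (dom_fin_num fn dy)).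
rewrite -(fineK (dom_fin_num gn dz)) -(fineK (dom_fin_num gn dd)).
rewrite -!EFinD !lee_fin /= dotpDl dotp_mulmx mulmxBr !dotpBr; lra.
Qed.

Hypotheses (flsc : lower_semicontinuous f) (glsc : lower_semicontinuous g).
Variables (x_ p_ : nat -> 'cV[R]_n) (z_ q_ : nat -> 'cV[R]_m).
Variables (x xi : 'cV[R]_n).
Hypotheses (xx : x_ @ \oo --> x) (zx : z_ @ \oo --> A *m x).
Hypotheses (fp : forall j, subdiff f (x_ j) (p_ j)).
Hypotheses (gq : forall j, subdiff g (z_ j) (q_ j)).
Hypotheses (pq : p_ j + A^T *m q_ j @[j --> \oo] --> xi).

Let gap : A *m x_ j - z_ j @[j --> \oo] --> (0 : 'cV[R]_m).
Proof. by rewrite -(subrr (A *m x)); apply: cvgB => //; exact: cvg_mulmx. Qed.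

Let near_fine_gt a b : (a%:E < f x)%E -> (b%:E < g (A *m x)%R)%E ->
  \forall j \near \oo, a + b <= fine (f (x_ j)) + fine (g (z_ j)).
Proof.
move=> /(lsc_near flsc xx) afx /(lsc_near glsc zx) bgx.
move: afx bgx; apply: filterS2 => j.
rewrite -(fineK (dom_fin_num fn (fp j).1)) -(fineK (dom_fin_num gn (gq j).1)).
by rewrite !lte_fin => /ltW ? /ltW ?; exact: lerD.
Qed.

(** In [subdiff_pair_ineq] with d = A y every term but the function values converges, and lower
    semicontinuity bounds these values from below by any a + b with a < f x and b < g (A x). *)
Lemma subdiff_objective_limit : dom (objective f g A) !=set0 ->
  dotp (q_ j) (A *m x_ j - z_ j) @[j --> \oo] --> 0 ->
  subdiff (objective f g A) x xi.
Proof.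
move=> [y0 dy0] qgap.
have bound a b y : (a%:E < f x)%E -> (b%:E < g (A *m x)%R)%E ->
    dom (objective f g A) y ->
    a + b + dotp xi (y - x) <= fine (f y) + fine (g (A *m y)).
  move=> afx bgx /dom_objective[fy gy].
  have /cvgr_to_le : (fun j => a + b + dotp (p_ j + A^T *m q_ j) (y - x_ j)
      + dotp (q_ j) (A *m x_ j - z_ j)) @ \oo --> a + b + dotp xi (y - x) + 0.
    apply: cvgD => //; apply: cvgD; first exact: cvg_cst.
    by apply: cvg_dotp => //; apply: cvgB => //; exact: cvg_cst.
  rewrite addr0; apply; have := near_fine_gt afx bgx; apply: filterS => j abj.
  have := subdiff_pair_ineq (fp j) (gq j) fy gy.
  rewrite subrr -{1}(scale0r 0) dotpZr mul0r; lra.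
(* If one value were +oo, its lower bound a or b could be taken arbitrarily large, against [bound]
   at [y0]. *)
have finx : f x \is a fin_num /\ g (A *m x) \is a fin_num.
  have [a afx] := gt_real (fn x); have [b bgx] := gt_real (gn (A *m x)).
  set K := fine (f y0) + fine (g (A *m y0)) - dotp xi (y0 - x).
  split; rewrite fin_numE ?fn ?gn/=; apply/eqP => h.
    have := bound (K - b + 1) b y0; rewrite h ltry => /(_ isT bgx dy0).
    by rewrite /K; lra.
  have := bound a (K - a + 1) y0; rewrite h ltry => /(_ afx isT dy0).
  by rewrite /K; lra.
have [/fineK fxE /fineK gxE] := finx.
split; first by rewrite /dom /= /objective -fxE -gxE -EFinD ltry.
move=> y dy; have [fy gy] := dom_objective dy.
rewrite /objective -fxE -gxE.
rewrite -(fineK (dom_fin_num fn fy)) -(fineK (dom_fin_num gn gy)).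
rewrite -!EFinD lee_fin.
apply/ler_addgt0Pr => e e0.
have fx_lt : ((fine (f x) - e / 2)%:E < f x)%E.
  by rewrite -{2}fxE lte_fin gtrBl divr_gt0.
have gx_lt : ((fine (g (A *m x)) - e / 2)%:E < g (A *m x)%R)%E.
  by rewrite -{2}gxE lte_fin gtrBl divr_gt0.
have := bound _ _ _ fx_lt gx_lt dy; lra.
Qed.

(* Adding the two subgradient inequalities at w = d - A y, with w in a ball
   around 0 given by the qualification, bounds [dotp (q_ j) w] from above up to
   an error [`|q_ j| * E j] with [E j] tending to 0; w = s e_i and w = - s e_i
   bound the coordinates of [q_ j]. *)
Lemma multiplier_bounded :
  interior [set w - A *m y | w in dom g & y in dom f] 0 ->
  exists K, \forall j \near \oo, `|q_ j| <= K.
Proof.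
move=> /nbhs_ballP[r /= r0 rS].
pose E : R^nat := fun j => m%:R * `|A *m x_ j - z_ j|.
have E0 : E @ \oo --> 0.
  rewrite -(mulr0 m%:R) /E; apply: cvgM; first exact: cvg_cst.
  by rewrite -[X in _ --> X](@normr0 _ 'cV[R]_m); exact: cvg_norm.
have [a afx] := gt_real (fn x); have [b bgx] := gt_real (gn (A *m x)).
have near_ab := near_fine_gt afx bgx.
have dir w : ball 0 r w ->
    exists C, \forall j \near \oo, dotp (q_ j) w <= C + `|q_ j| * E j.
  move=> /rS[d dd [y dy <-]].
  exists (fine (f y) + fine (g d) - (a + b) + 1 - dotp xi (y - x)).
  have : dotp (p_ j + A^T *m q_ j) (y - x_ j) @[j --> \oo] --> dotp xi (y - x).
    by apply: cvg_dotp => //; apply: cvgB => //; exact: cvg_cst.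
  move=> /cvgr_ge /(_ (dotp xi (y - x) - 1)); rewrite gtrBl => /(_ ltr01).
  move: near_ab; apply: filterS2 => j abj xij.
  have := subdiff_pair_ineq (fp j) (gq j) dy dd.
  have := dotp_le (q_ j) (A *m x_ j - z_ j).
  by rewrite ler_norml mulrCA -/(E j) => /andP[? _]; lra.
have coord i : exists C,
    \forall j \near \oo, `|q_ j i 0| * (r / 2) <= C + `|q_ j| * E j.
  (* Half the radius keeps s e_i inside the open ball. *)
  have dirs s : `|s| <= r / 2 -> exists C,
      \forall j \near \oo, s * q_ j i 0 <= C + `|q_ j| * E j.
    move=> sr; have [|C hC] := dir (s *: delta_mx i 0).
      rewrite -ball_normE /ball_ /= sub0r normrN.
      apply: (@le_lt_trans _ _ (r / 2)); last first.
        by rewrite ltr_pdivrMr// ltr_pMr// ltr1n.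
      apply: norm_le_coord => [|k]; first by rewrite divr_ge0// ltW.
      rewrite !mxE normrM andbT; case: eqP => _.
        by rewrite normr1 mulr1.
      by rewrite normr0 mulr0 divr_ge0// ltW.
    exists C; move: hC; apply: filterS => j; rewrite dotpZr.
    rewrite /dotp (bigD1 i)//= !mxE !eqxx mulr1 big1 ?addr0// => k ki.
    by rewrite mxE (negbTE ki) mulr0.
  have r2 : 0 <= r / 2 by rewrite divr_ge0// ltW.
  have [C1 h1] := dirs (r / 2) ltac:(by rewrite ger0_norm).
  have [C2 h2] := dirs (- (r / 2)) ltac:(by rewrite normrN ger0_norm).
  exists (Num.max C1 C2); move: h1 h2; apply: filterS2 => j h1 h2.
  have C1m : C1 <= Num.max C1 C2 by rewrite le_max lexx.
  have C2m : C2 <= Num.max C1 C2 by rewrite le_max lexx orbT.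
  by case: (ger0P (q_ j i 0)) => _; lra.
have [C hC] := choice coord.
(* Write K for the sum, which dominates every C i. Once E j <= r / 4, the coordinate bounds give
   [|q_ j|] r / 2 <= K + [|q_ j|] r / 4, and the last term is absorbed on the left. *)
exists (4 * (\sum_i `|C i|) / r).
have Ej4 : \forall j \near \oo, `|E j| <= r / 4.
  exact: (cvgr0_norm_le _ E0 (r / 4) (divr_gt0 r0 (ltr0Sn _ 3))).
have Cj : \forall j \near \oo, forall i,
    `|q_ j i 0| * (r / 2) <= C i + `|q_ j| * E j by exact: filter_forall.
move: Ej4 Cj; apply: filterS2 => j Ej hj.
set K := \sum_i _ in hj *.
have {}Ej : E j <= r / 4 := le_trans (ler_norm _) Ej.
have K0 : 0 <= K by apply: sumr_ge0.
have : `|q_ j| <= (K + `|q_ j| * (r / 4)) / (r / 2).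
  apply: norm_le_coord => [|i].
    by rewrite divr_ge0 ?addr_ge0 ?mulr_ge0 ?divr_ge0// ltW.
  rewrite ler_pdivlMr ?divr_gt0//; apply: (le_trans (hj i)); apply: lerD.
    by rewrite (le_trans (ler_norm _))// /K (bigD1 i)//= lerDl sumr_ge0.
  exact: ler_wpM2l.
rewrite ler_pdivlMr ?divr_gt0// ler_pdivlMr// => H; lra.
Qed.

End SumRule.

(** * Limits along the grids *)

Lemma grid_bigO_vanishes {R : realType} {d : nat} t
    (err : R -> nat -> 'cV[R]_d) :
  grid_bigO t err -> grid_vanishes t err.
Proof.
move=> [C hC] e e0.
have C0 : 0 < `|C| / e + 1 by rewrite ltr_wpDl// divr_ge0// ltW.
(* Beyond this threshold sqrt rho >= [|C|] / e + 1, so that C / sqrt rho <= e. *)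
have : \forall rho \near +oo, (`|C| / e + 1) ^+ 2 <= rho.
  by apply: nbhs_pinfty_ge; rewrite num_real.
move: hC; apply: filterS2 => rho hC rho_ge k kt; apply: (le_trans (hC k kt)).
have s0 : `|C| / e + 1 <= Num.sqrt rho.
  by rewrite -(ger0_norm (ltW C0)) -sqrtr_sqr ler_wsqrtr.
rewrite /step ler_pdivrMr ?(lt_le_trans C0)// (le_trans (ler_norm _))//.
by rewrite mulrC -ler_pdivrMr// (le_trans _ s0)// lerDl.
Qed.

(** The index sequence is left free: [j.+1] serves at times t > 0, the constant 0 at t = 0. *)
Lemma grid_vanishes_cvg {R : realType} {d : nat} t (err : R -> nat -> 'cV[R]_d)
    (rho : nat -> R) (k : nat -> nat) :
  rho @ \oo --> +oo -> (forall j, grid_time (rho j) (k j) = t) ->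
  grid_vanishes t err -> err (rho j) (k j) @[j --> \oo] --> (0 : 'cV[R]_d).
Proof.
move=> rhoy kt errt; apply/cvgr0Pnorm_le => e e0.
have : \forall j \near \oo, forall k', grid_time (rho j) k' = t ->
  norm2 (err (rho j) k') <= e by exact: (rhoy _ (errt _ e0)).
apply: filterS => j /(_ _ (kt j)); exact: le_trans (norm_le_norm2 _).
Qed.

Lemma step_pow2 {R : realType} (s : R) : 0 <= s -> step (s ^+ 2) = s^-1.
Proof. by move=> s0; rewrite /step sqrtr_sqr ger0_norm. Qed.

Lemma cvg_sqr_grid {R : realType} (t : R) : 0 < t ->
  (j.+1%:R / t) ^+ 2 @[j --> \oo] --> +oo.
Proof.
move=> t0; apply/cvgryPge => M.
have : \forall j \near \oo, t * (`|M| + 1) <= j%:R.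
  by apply: nbhs_infty_ger.
apply: filterS => j tj.
have : `|M| + 1 <= j.+1%:R / t.
  by rewrite ler_pdivlMr// mulrC (le_trans tj)// ler_nat.
move=> h; apply: (le_trans (ler_norm _)).
have : 0 <= `|M| by []. rewrite expr2; nra.
Qed.

Lemma cvg0_scaled_bounded {R : realType} {d : nat} (rho : nat -> R)
    (v : nat -> 'cV[R]_d) K :
  rho @ \oo --> +oo -> (\forall j \near \oo, `|rho j *: v j| <= K) ->
  v @ \oo --> (0 : 'cV[R]_d).
Proof.
move=> /cvgryPge rhoy vK; apply/cvgr0Pnorm_le => e e0.
move: (rhoy ((`|K| + 1) / e)) vK; apply: filterS2 => j.
rewrite normrZ ler_pdivrMr// => rj vj.
have rj0 : 0 < rho j.
  by rewrite -(pmulr_lgt0 _ e0) (lt_le_trans _ rj)// ltr_wpDl.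
rewrite gtr0_norm// in vj; rewrite -(ler_pM2l rj0) (le_trans vj)//.
by rewrite (le_trans _ rj)// (le_trans (ler_norm _))// lerDl.
Qed.

Lemma cvg0_scaled_cvg {R : realType} {d : nat} (rho : nat -> R)
    (v : nat -> 'cV[R]_d) (l : 'cV[R]_d) :
  rho @ \oo --> +oo -> rho j *: v j @[j --> \oo] --> l ->
  v @ \oo --> (0 : 'cV[R]_d).
Proof.
move=> rhoy vl; apply: (@cvg0_scaled_bounded _ _ rho _ (`|l| + 1)) => //.
by apply: cvgr_norm_le vl _ _; rewrite ltrDl.
Qed.

Lemma cvg_bounded_dotp0 {R : realType} {d : nat} (q v : nat -> 'cV[R]_d) K :
  (\forall j \near \oo, `|q j| <= K) -> v @ \oo --> (0 : 'cV[R]_d) ->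
  dotp (q j) (v j) @[j --> \oo] --> 0.
Proof.
move=> qK v0; apply: norm_cvg0.
have E0 : d%:R * (K * `|v j|) @[j --> \oo] --> 0.
  have -> : 0 = d%:R * (K * `|0 : 'cV[R]_d|) by rewrite normr0 !mulr0.
  by apply: cvgM; [exact: cvg_cst|apply: cvgM; [exact: cvg_cst|exact: cvg_norm]].
apply: squeeze_cvgr E0; last exact: cvg_cst.
move: qK; apply: filterS => j qK; rewrite normr_ge0/=.
by apply: (le_trans (dotp_le _ _)); rewrite ler_wpM2l// ler_wpM2r.
Qed.

(** * The limit of one iteration along a sequence of parameters *)

Section AdmmLimit.
Context {R : realType} {n m : nat}.
Variables (f : 'cV[R]_n -> \bar R) (g : 'cV[R]_m -> \bar R) (A : 'M[R]_(m, n)).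
Variable (alpha : R).
Hypotheses (hS1 : assumption_S1 f g A) (alpha_gt0 : 0 < alpha).
Variables (rho : nat -> R) (x : nat -> 'cV[R]_n) (z u zh uh : nat -> 'cV[R]_m).
Hypotheses (rho_gt0 : forall j, 0 < rho j) (rhoy : rho @ \oo --> +oo).
Hypothesis (hx : forall j, argmin (fun w => ((rho j)^-1)%R%:E * f w
      + (2^-1 * norm2 (A *m w - (zh j - uh j)) ^+ 2)%R%:E)%E (x j)).
Hypothesis (hz : forall j, argmin (fun w => ((rho j)^-1)%R%:E * g w
      + (2^-1 * norm2 (w - (alpha *: (A *m x j) + (1 - alpha) *: zh j
                            + uh j)) ^+ 2)%R%:E)%E (z j)).
Hypothesis (hu : forall j,
  u j = uh j + alpha *: (A *m x j) + (1 - alpha) *: zh j - z j).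
Variables (a : 'cV[R]_n) (b c zeta mu : 'cV[R]_m).
Hypotheses (xa : x @ \oo --> a) (zb : z @ \oo --> b) (uc : u @ \oo --> c).
Hypothesis (z_zeta : rho j *: (z j - zh j) @[j --> \oo] --> zeta).
Hypothesis (u_mu : rho j *: (u j - uh j) @[j --> \oo] --> mu).
Hypothesis (phi_dom : dom (objective f g A) !=set0).

(** Here x, z, u stand for the iterates of index k + 1 and zh, uh for the extrapolated ones of index
    k. Boundedness of q = rho u yields both c = 0 and the vanishing of <q, A x - z>, which
    [subdiff_objective_limit] requires. *)
Lemma admm_limit :
  [/\ b = A *m a, c = 0 & subdiff (objective f g A) a
      (A^T *m (mu - alpha^-1 *: (mu + zeta)))].
Proof using All.
have [[fn fd] [gn gd] _ _ flsc glsc fcvx gcvx _ _ qual] := hS1.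
(* The u-update solved for A x; its right-hand side is of order 1 / rho. *)
have residual j : A *m x j - zh j = alpha^-1 *: ((u j - uh j) + (z j - zh j)).
  rewrite hu; apply/matrixP => i k; rewrite !mxE; field.
  by rewrite gt_eqF.
have zz : z j - zh j @[j --> \oo] --> (0 : 'cV[R]_m).
  exact: cvg0_scaled_cvg rhoy z_zeta.
have uu : u j - uh j @[j --> \oo] --> (0 : 'cV[R]_m).
  exact: cvg0_scaled_cvg rhoy u_mu.
have Axz : A *m x j - z j @[j --> \oo] --> (0 : 'cV[R]_m).
  have : alpha^-1 *: ((u j - uh j) + (z j - zh j)) - (z j - zh j)
      @[j --> \oo] --> alpha^-1 *: (0 + 0) - (0 : 'cV[R]_m).
    by apply: cvgB => //; apply: cvgZ; [exact: cvg_cst|exact: cvgD].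
  rewrite addr0 scaler0 subr0; apply: cvg_trans.
  apply: near_eq_cvg; apply: nearW => j.
  by rewrite -residual; apply/matrixP => i k; rewrite !mxE; ring.
have bE : b = A *m a.
  apply: (norm_cvg_unique zb).
  have : A *m x j - (A *m x j - z j) @[j --> \oo] --> A *m a - 0.
    by apply: cvgB => //; exact: cvg_mulmx.
  rewrite subr0; apply: cvg_trans.
  apply: near_eq_cvg; apply: nearW => j.
  by rewrite opprB addrCA subrr addr0.
have zAa : z @ \oo --> A *m a by rewrite -bE.
have fp j : subdiff f (x j) (rho j *: (A^T *m ((zh j - uh j) - A *m x j))).
  by apply: argmin_quadratic_subdiff.
have gq j : subdiff g (z j) (rho j *: u j).
  (* By the u-update, u is the residual of the z-minimization, in the shape that
     [argmin_quadratic_subdiff] gives for the identity matrix. *)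
  have -> : u j = (1%:M)^T *m (alpha *: (A *m x j) + (1 - alpha) *: zh j + uh j
      - 1%:M *m z j).
    by rewrite trmx1 !mul1mx hu; apply/matrixP => i k; rewrite !mxE; ring.
  apply: argmin_quadratic_subdiff => //.
  by under eq_fun do rewrite mul1mx; exact: hz.
(* The sum equals rho A^T ((u - uh) - (A x - zh)), and [residual] rewrites the second difference. *)
have pq : rho j *: (A^T *m ((zh j - uh j) - A *m x j))
    + A^T *m (rho j *: u j) @[j --> \oo]
    --> A^T *m (mu - alpha^-1 *: (mu + zeta)).
  have : A^T *m (rho j *: (u j - uh j) - alpha^-1 *:
      (rho j *: (u j - uh j) + rho j *: (z j - zh j))) @[j --> \oo]
      --> A^T *m (mu - alpha^-1 *: (mu + zeta)).
    apply: cvg_mulmx; apply: cvgB => //; apply: cvgZ; [exact: cvg_cst|exact: cvgD].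
  apply: cvg_trans.
  apply: near_eq_cvg; apply: nearW => j.
  rewrite -scalerDr scalerA mulrC -scalerA -residual scalemxAr -mulmxDr.
  by congr (_ *m _); apply/matrixP => i k; rewrite !mxE; ring.
have [K qK] : exists K, \forall j \near \oo, `|rho j *: u j| <= K.
  exact: (multiplier_bounded fn gn flsc glsc xa zAa fp gq pq qual).
split=> //; last first.
  apply: (subdiff_objective_limit _ _ _ _ xa zAa fp gq pq) => //.
  exact: (cvg_bounded_dotp0 qK Axz).
by apply: (norm_cvg_unique uc); exact: cvg0_scaled_bounded qK.
Qed.

End AdmmLimit.

(* The parameters rho whose grid contains t > 0, at the index j.+1. *)
Definition sqr_grid {R : realType} (t : R) (j : nat) : R := (j.+1%:R / t) ^+ 2.

(** * Iterates and differences along the grids through a fixed positive time *)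

Section GridPoint.
Context {R : realType} {d : nat} {t : R}.
Hypothesis (t_gt0 : 0 < t).
Variables (y : R -> nat -> 'cV[R]_d).

Lemma sqr_grid_gt0 j : 0 < sqr_grid t j.
Proof. by rewrite exprn_gt0// divr_gt0. Qed.

Lemma step_sqr_grid j : step (sqr_grid t j) = t / j.+1%:R.
Proof. by rewrite step_pow2 ?divr_ge0 ?ltW// invf_div. Qed.

Lemma grid_time_sqr_grid j : grid_time (sqr_grid t j) j.+1 = t.
Proof. by rewrite /grid_time step_sqr_grid divfK// pnatr_eq0. Qed.

Lemma cvg_step_sqr_grid : step (sqr_grid t j) @[j --> \oo] --> 0.
Proof.
under eq_fun do rewrite step_sqr_grid.
rewrite -(mulr0 t); apply: cvgM; first exact: cvg_cst.
exact: cvg_harmonic.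
Qed.

Lemma grid_cvg0 (err : R -> nat -> 'cV[R]_d) : grid_bigO t err ->
  err (sqr_grid t j) j.+1 @[j --> \oo] --> (0 : 'cV[R]_d).
Proof.
move=> /grid_bigO_vanishes; apply: grid_vanishes_cvg (cvg_sqr_grid t_gt0) _.
exact: grid_time_sqr_grid.
Qed.

Lemma grid_cvg (F : R -> nat -> 'cV[R]_d) (l : 'cV[R]_d) :
  grid_bigO t (fun rho k => F rho k - l) ->
  F (sqr_grid t j) j.+1 @[j --> \oo] --> l.
Proof. by move=> /grid_cvg0 Fl; apply/subr_cvg0. Qed.

(** The next iterate differs from the one at time t by the step times a convergent forward
    difference. *)
Lemma cvg_grid_next (Y Y1 : 'cV[R]_d) :
  grid_vanishes t (fun rho k => y rho k - Y) ->
  grid_bigO t (fun rho k => (step rho)^-1 *: (y rho k.+1 - y rho k) - Y1) ->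
  y (sqr_grid t j) j.+2 @[j --> \oo] --> Y.
Proof.
move=> /(grid_vanishes_cvg (cvg_sqr_grid t_gt0) grid_time_sqr_grid)/subr_cvg0 yY.
move=> /grid_cvg yY1.
have yE j : y (sqr_grid t j) j.+2 = y (sqr_grid t j) j.+1
    + step (sqr_grid t j) *: ((step (sqr_grid t j))^-1 *:
        (y (sqr_grid t j) j.+2 - y (sqr_grid t j) j.+1)).
  rewrite scalerA mulfV ?scale1r 1?addrC ?subrK//.
  by rewrite step_sqr_grid gt_eqF// divr_gt0.
under eq_fun do rewrite yE.
by rewrite -[Y]addr0 -(scale0r Y1); apply: cvgD => //; apply: cvgZ => //;
  exact: cvg_step_sqr_grid.
Qed.

(** Since rho = step^-2, the factor 1 - r / sqrt rho splits the expression into the second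
    difference over step^2 plus r times the backward difference quotient. The grid index of t is
    [j.+1], so its predecessor [j] always exists. *)
Lemma cvg_grid_acceleration (r : R) (Y1 Y2 : 'cV[R]_d) :
  grid_bigO t (fun rho k => (step rho)^-1 *: (y rho k - y rho k.-1) - Y1) ->
  grid_bigO t (fun rho k =>
    (step rho ^+ 2)^-1 *: (y rho k.+1 - 2 *: y rho k + y rho k.-1) - Y2) ->
  sqr_grid t j *: (y (sqr_grid t j) j.+2 - (y (sqr_grid t j) j.+1
    + (1 - r / Num.sqrt (sqr_grid t j)) *:
        (y (sqr_grid t j) j.+1 - y (sqr_grid t j) j))) @[j --> \oo]
  --> Y2 + r *: Y1.
Proof.
move=> /grid_cvg yY1 /grid_cvg yY2.
have yE j : sqr_grid t j *: (y (sqr_grid t j) j.+2 - (y (sqr_grid t j) j.+1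
      + (1 - r / Num.sqrt (sqr_grid t j)) *:
        (y (sqr_grid t j) j.+1 - y (sqr_grid t j) j)))
    = (step (sqr_grid t j) ^+ 2)^-1 *: (y (sqr_grid t j) j.+2
        - 2 *: y (sqr_grid t j) j.+1 + y (sqr_grid t j) j)
      + r *: ((step (sqr_grid t j))^-1 *:
        (y (sqr_grid t j) j.+1 - y (sqr_grid t j) j)).
  have s0 : Num.sqrt (sqr_grid t j) != 0.
    by rewrite gt_eqF// sqrtr_gt0 sqr_grid_gt0.
  rewrite /step exprVn !invrK; move: s0 (sqr_sqrtr (ltW (sqr_grid_gt0 j))).
  move: (Num.sqrt _) => s s0 sE.
  by rewrite -{1}sE; apply/matrixP => k l; rewrite !mxE; field.
under eq_fun do rewrite yE.
by apply: cvgD => //; apply: cvgZ => //; exact: cvg_cst.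
Qed.


End GridPoint.

(** * The initial velocity *)

Lemma full_column_rank_inj {R : realType} {n m : nat} (A : 'M[R]_(m, n)) v :
  \rank A = n -> A *m v = 0 :> 'cV[R]_m -> v = 0 :> 'cV[R]_n.
Proof.
move=> rA Av; have freeA : row_free A^T by rewrite /row_free mxrank_tr rA.
apply: trmx_inj; apply/eqP; rewrite trmx0 -(mulmx_free_eq0 _ freeA).
by rewrite -trmx_mul Av trmx0.
Qed.

Lemma dotp_eq0 {R : realType} {d : nat} (v : 'cV[R]_d) : dotp v v <= 0 -> v = 0.
Proof.
move=> v0; apply/eqP; rewrite -normr_le0 (le_trans (norm_le_norm2 _))//.
by rewrite /norm2 (eqP (_ : dotp v v == 0)) ?sqrtr0// eq_le v0 dotp_ge0.
Qed.

(** A vector v in the kernel of A^T A satisfies <A v, A v> = 0, so A v = 0 and v = 0. *)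
Lemma gram_unitmx {R : realType} {n m : nat} (A : 'M[R]_(m, n)) :
  \rank A = n -> A^T *m A \in unitmx.
Proof.
move=> rA; rewrite -row_free_unit; apply: inj_row_free => v vAA.
apply: trmx_inj; rewrite trmx0; apply: (full_column_rank_inj rA).
apply: dotp_eq0; rewrite -dotp_mulmx.
have -> : A^T *m (A *m v^T) = (v *m (A^T *m A))^T.
  by rewrite !trmx_mul trmxK mulmxA.
by rewrite vAA trmx0 -(scale0r 0) dotpZl mul0r.
Qed.

(* Comparing x1 with x0 in the minimization gives
   [dotp (A *m v) (A *m v) <= 2 (f x0 - f x1)] for v = (x1 - x0) / eps, and the
   right-hand side is asymptotically at most 0 by lower semicontinuity. *)
Lemma prox_first_step {R : realType} {n m : nat} (f : 'cV[R]_n -> \bar R)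
    (A : 'M[R]_(m, n)) x0 (eps : nat -> R) (x1 : nat -> 'cV[R]_n)
    (V : 'cV[R]_n) :
  never_ninfty f -> lower_semicontinuous f -> dom f x0 ->
  (forall j, 0 < eps j) -> eps @ \oo --> 0 ->
  (forall j, argmin (fun w => (eps j ^+ 2)%:E * f w
     + (2^-1 * norm2 (A *m w - A *m x0) ^+ 2)%R%:E)%E (x1 j)) ->
  (eps j)^-1 *: (x1 j - x0) @[j --> \oo] --> V ->
  A *m V = 0.
Proof.
move=> fn flsc dx0 eps0 epsc hx xV.
have xx : x1 @ \oo --> x0.
  have xE j : x1 j = x0 + eps j *: ((eps j)^-1 *: (x1 j - x0)).
    by rewrite scalerA mulfV ?gt_eqF// scale1r addrC subrK.
  rewrite [X in X @ _](funext xE).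
  rewrite -[X in _ --> X]addr0 -(scale0r V).
  by apply: cvgD; [exact: cvg_cst|exact: cvgZ].
apply: dotp_eq0; apply/ler_addgt0Pr => e e0; rewrite add0r.
have AVV : dotp (A *m ((eps j)^-1 *: (x1 j - x0)))
    (A *m ((eps j)^-1 *: (x1 j - x0))) @[j --> \oo] --> dotp (A *m V) (A *m V).
  by apply: cvg_dotp; exact: cvg_mulmx.
apply: (cvgr_to_le AVV).
have fx0E := fineK (dom_fin_num fn dx0).
(* A loss of e / 2 is allowed because the comparison bounds the square by twice the decrease of
   f. *)
have : ((fine (f x0) - e / 2)%:E < f x0)%E.
  by rewrite -{2}fx0E lte_fin gtrBl divr_gt0.
move=> /(lsc_near flsc xx); apply: filterS => j.
have := hx j x0.
rewrite subrr -{1}fx0E -EFinM -EFinD norm2_sqr.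
set w := A *m x1 j - A *m x0.
have e2 : 0 < eps j ^+ 2 by rewrite exprn_gt0.
have := fn (x1 j); case: (f (x1 j)) => [s||]// _; last first.
  by rewrite gt0_muley ?lte_fin// addye// leye_eq.
rewrite -EFinM -EFinD lee_fin lte_fin norm2_sqr.
rewrite -scalemxAr mulmxBr -/w dotpZl dotpZr -(scale0r 0) dotpZl mul0r.
rewrite mulrA -expr2 exprVn ler_pdivrMl// => h1 h2; nra.
Qed.

(** * Derivatives on a segment *)

Section DerivativeOn.
Context {R : realType} {d : nat} {T : R}.
Implicit Types (Y : R -> 'cV[R]_d) (t : R) (v : 'cV[R]_d).

Lemma derivative_on_coord Y t v i e : derivative_on T Y t v -> 0 < e ->
  exists2 delta, 0 < delta & forall s, s != t -> `|s - t| < delta ->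
    0 <= s <= T -> `|(s - t)^-1 * (Y s i 0 - Y t i 0) - v i 0| <= e.
Proof.
move=> /cvgr_distC_le Yv e0.
have [delta /= d0 dP] := Yv e e0.
exists delta => // s st sd sT.
have := dP s; rewrite /= distrC in_itv/= => /(_ sd st sT) H.
by have := le_trans (coord_le_norm _ i) H; rewrite !mxE.
Qed.

Lemma is_derive_derivative_on Y t v i : 0 < t < T -> derivative_on T Y t v ->
  is_derive t 1 (fun s => Y s i 0) (v i 0).
Proof.
move=> /andP[t0 tT] Yv.
have lim : h^-1 *: (((fun s => Y s i 0) \o shift t) (h *: 1) - Y t i 0)
    @[h --> 0^'] --> v i 0.
  apply/cvgrPdistC_le => e e0.
  have [delta d0 dP] := derivative_on_coord i Yv e0.
  have m0 : 0 < Num.min delta (Num.min t (T - t)).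
    by rewrite !lt_min d0 t0 subr_gt0.
  (* The bounds t and T - t keep t + h in the segment, where the relative derivative gives
     information. *)
  exists (Num.min delta (Num.min t (T - t))) => //= h.
  rewrite /ball_ /= sub0r normrN !lt_min => /andP[hd /andP[ht hT]] h0.
  rewrite [h *: 1]mulr1.
  have := dP (h + t); rewrite addrK -subr_eq0 addrK; apply => //.
  move: ht hT; rewrite !ltr_norml => /andP[? ?] /andP[? ?]; lra.
apply: DeriveDef; first by apply/cvg_ex; exists (v i 0).
exact: cvg_lim lim.
Qed.

(** At an interior time the relative derivative is the ordinary one, hence local. Agreement on the
    open interval is the form in which U = 0 and Z = A X become available. *)
Lemma derivative_on_unique Y Y' t v v' : 0 < t < T ->
  derivative_on T Y t v -> derivative_on T Y' t v' ->
  (forall s, 0 < s < T -> Y s = Y' s) -> v = v'.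
Proof.
move=> t0T Yv Yv' YY'; apply/matrixP => i j; rewrite (ord1 j).
have D := is_derive_derivative_on i t0T Yv.
have D' := is_derive_derivative_on i t0T Yv'.
rewrite -(@derive_val _ _ _ _ _ _ _ D) -(@derive_val _ _ _ _ _ _ _ D').
apply: near_eq_derive.
have [t0 tT] := andP t0T.
near=> s; rewrite YY'//; apply/andP; split; near: s.
  exact: lt_nbhsr.
exact: lt_nbhsl.
Unshelve. all: by end_near. Qed.

Lemma derivative_on_mulmx k (B : 'M[R]_(k, d)) Y t v :
  derivative_on T Y t v -> derivative_on T (fun s => B *m Y s) t (B *m v).
Proof.
move=> Yv; rewrite /derivative_on.
under eq_fun do rewrite -mulmxBr scalemxAr.
exact: cvg_mulmx.
Qed.

Lemma derivative_on_cst0 t : derivative_on T (fun _ => 0 : 'cV[R]_d) t 0.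
Proof.
rewrite /derivative_on; under eq_fun do rewrite subrr scaler0.
exact: cvg_cst.
Qed.

End DerivativeOn.

Lemma lipschitz_absolutely_continuous {R : realType} {d : nat} (T K : R)
    (Y : R -> 'cV[R]_d) :
  (forall a b, 0 <= a -> a <= b -> b <= T ->
     norm2 (Y b - Y a) <= K * (b - a)) ->
  absolutely_continuous_on T Y.
Proof.
move=> YK e e0; exists (e / (`|K| + 1)) => [|s sT _ ssum].
  by rewrite divr_gt0// ltr_wpDl.
apply: (@le_lt_trans _ _ (\sum_(p <- s) (`|K| + 1) * (p.2 - p.1))).
  rewrite big_seq [leRHS]big_seq; apply: ler_sum => p ps.
  have /and3P[p0 p12 pT] := allP sT _ ps.
  apply: (le_trans (YK _ _ p0 p12 pT)); rewrite ler_wpM2r ?subr_ge0//.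
  by rewrite (le_trans (ler_norm _))// lerDl.
by rewrite -mulr_sumr mulrC -ltr_pdivlMr// ltr_wpDl.
Qed.

Lemma mulmx_bounded {R : realType} {n m : nat} (B : 'M[R]_(m, n)) :
  exists2 C, 0 <= C & forall v : 'cV[R]_n, `|B *m v| <= C * `|v|.
Proof.
exists (\sum_i \sum_j `|B i j|) => [|v].
  by apply: sumr_ge0 => i _; apply: sumr_ge0.
apply: norm_le_coord => [|i].
  by rewrite mulr_ge0//; apply: sumr_ge0 => i _; apply: sumr_ge0.
rewrite mxE (le_trans (ler_norm_sum _ _ _))//.
apply: (@le_trans _ _ ((\sum_j `|B i j|) * `|v|)).
  rewrite mulr_suml; apply: ler_sum => j _.
  by rewrite normrM ler_wpM2l// coord_le_norm.
rewrite ler_wpM2r// [leRHS](bigD1 i)//= lerDl.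
by apply: sumr_ge0 => k _; apply: sumr_ge0.
Qed.

Lemma lipschitz_of_derive_bounded {R : realType} (h dh : R -> R) (a b K : R) :
  a <= b -> (forall s, a < s < b -> is_derive s 1 h (dh s)) ->
  {within `[a, b], continuous h} ->
  (forall s, a < s < b -> `|dh s| <= K) -> `|h b - h a| <= K * (b - a).
Proof.
rewrite le_eqVlt => /predU1P[-> *|ab hd hc hK].
  by rewrite !subrr normr0 mulr0.
have hd' s : s \in `]a, b[ -> is_derive s 1 h (dh s).
  by rewrite in_itv; exact: hd.
have [s sab ->] := MVT ab hd' hc.
have ba : 0 <= b - a by rewrite subr_ge0 ltW.
by rewrite normrM (ger0_norm ba) ler_wpM2r// hK//; rewrite in_itv in sab.
Qed.

Local Ltac itv_lra :=
  lazymatch goal with |- is_true (_ && _) => apply/andP; split | _ => idtac end;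
  lra.

(** * Lipschitz estimates for a scalar motion p with velocity v and acceleration w *)

Section DampedMotion.
Context {R : realType}.
Variables (T r M B : R) (p v w : R -> R).
Implicit Types a b e s t : R.
Hypotheses (T_gt0 : 0 < T) (r_ge0 : 0 <= r).
Hypotheses (pc : {within `[0, T], continuous p})
  (pM : forall t, 0 <= t <= T -> `|p t| <= M).
Hypotheses (pv : forall t, 0 < t < T -> is_derive t 1 p (v t))
  (vw : forall t, 0 < t < T -> is_derive t 1 v (w t))
  (wB : forall t, 0 < t < T -> `|w t + r * v t| <= B).
Hypothesis pv_ends : forall t e, 0 <= t <= T -> 0 < e ->
  exists2 delta, 0 < delta & forall s, s != t -> `|s - t| < delta ->
    0 <= s <= T -> `|(s - t)^-1 * (p s - p t) - v t| <= e.

Let pc_sub a b : 0 <= a -> b <= T -> {within `[a, b], continuous p}.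
Proof.
move=> a0 bT; apply: continuous_subspaceW pc => x /=.
by rewrite !in_itv/= => /andP[? ?]; apply/andP; split; lra.
Qed.

Let midT : 0 < T / 2 < T.
Proof. by rewrite divr_gt0//= ltr_pdivrMr// ltr_pMr// ltr1n. Qed.

Let B_ge0 : 0 <= B.
Proof. exact: le_trans (normr_ge0 _) (wB midT). Qed.

(* h' = w + r v is bounded, so h is Lipschitz, and v = h - r p inherits first
   boundedness and then the Lipschitz property. *)
Let h t := v t + r * p t.

Let h_lipschitz a b : 0 < a -> a <= b -> b < T -> `|h b - h a| <= B * (b - a).
Proof.
move=> a0 ab bT.
have hd s : 0 < s < T -> is_derive s 1 h (w s + r * v s).
  move=> sT; have := pv sT; have := vw sT => dv dp.
  exact: is_deriveD.
apply: (@lipschitz_of_derive_bounded _ _ (fun s => w s + r * v s)) => //.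
- by move=> s /andP[? ?]; apply: hd; itv_lra.
- apply: derivable_within_continuous => s; rewrite in_itv/= => /andP[? ?].
  by have [] := hd s ltac:(itv_lra).
- by move=> s /andP[? ?]; apply: wB; itv_lra.
Qed.

(** A bound for v = h - r p: the value of h at the midpoint, its variation over a time at most T,
    and r times the bound of p. *)
Let V := `|h (T / 2)| + B * T + r * M.

Let v_bounded t : 0 < t < T -> `|v t| <= V.
Proof.
move=> /andP[t0 tT].
have ht : `|h t - h (T / 2)| <= B * T.
  have [tT2|tT2] := leP t (T / 2).
    rewrite distrC; apply: le_trans (h_lipschitz _ _ _) _ => //; try lra.
    by rewrite ler_wpM2l//; lra.
  apply: le_trans (h_lipschitz _ _ _) _ => //; try lra.
  by rewrite ler_wpM2l//; lra.
have -> : v t = h t - h (T / 2) + h (T / 2) - r * p t by rewrite /h; ring.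
rewrite /V; apply: (le_trans (ler_normB _ _)); apply: lerD.
  by apply: (le_trans (ler_normD _ _)); rewrite addrC lerD.
by rewrite normrM ger0_norm// ler_wpM2l// pM//; itv_lra.
Qed.

Let p_lipschitz a b : 0 <= a -> a <= b -> b <= T -> `|p b - p a| <= V * (b - a).
Proof.
move=> a0 ab bT; apply: (@lipschitz_of_derive_bounded _ _ v) => //.
- by move=> s /andP[? ?]; apply: pv; itv_lra.
- exact: pc_sub.
- by move=> s /andP[? ?]; apply: v_bounded; itv_lra.
Qed.

Let v_lipschitz_interior a b : 0 < a -> a <= b -> b < T ->
  `|v b - v a| <= (B + r * V) * (b - a).
Proof.
move=> a0 ab bT.
have -> : v b - v a = (h b - h a) - r * (p b - p a) by rewrite /h; ring.
apply: (le_trans (ler_normB _ _)); rewrite mulrDl; apply: lerD.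
  exact: h_lipschitz.
by rewrite normrM ger0_norm// -mulrA ler_wpM2l// p_lipschitz//; lra.
Qed.

(* Carries the Lipschitz bound for v to 0 and T, where v is only a one-sided
   derivative of p. *)
Let v_approx t e : 0 <= t <= T -> 0 < e ->
  exists s, [/\ 0 < s < T, `|s - t| <= e & `|v s - v t| <= e].
Proof.
move=> tT e0; have [delta d0 dP] := pv_ends tT e0.
have [t0 t1] := andP tT.
have [s [sT st sd se]] : exists s,
    [/\ 0 < s < T, s != t, `|s - t| < delta & `|s - t| <= e].
  (* The time s lies at distance q from t, on the side facing the midpoint; q <= T / 4 keeps it
     inside the open interval. *)
  pose q := Num.min (delta / 2) (Num.min e (T / 4)).
  have q0 : 0 < q by rewrite !lt_min e0 !divr_gt0.
  have qd : q <= delta / 2 by rewrite ge_min lexx.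
  have qe : q <= e by rewrite !ge_min lexx orbT.
  have qT : q <= T / 4 by rewrite !ge_min lexx !orbT.
  have [tT2|tT2] := leP t (T / 2).
    exists (t + q); rewrite addrAC subrr add0r gtr0_norm//.
    by split; [itv_lra|rewrite gt_eqF//; lra|lra|lra].
  exists (t - q); rewrite addrAC subrr add0r normrN gtr0_norm//.
  by split; [itv_lra|rewrite lt_eqF//; lra|lra|lra].
have {dP} := dP s st sd _; have [s0 s1] := andP sT.
have pd a b : 0 <= a -> b <= T ->
    forall c, c \in `]a, b[ -> is_derive c 1 p (v c).
  by move=> a0 bT c; rewrite in_itv/= => /andP[? ?]; apply: pv; itv_lra.
(* By the mean value theorem the difference quotient between s and t equals v at an intermediate
   time c, which is the required point. *)
have [ts|ts|ts] := ltgtP t s; last by rewrite ts eqxx in st.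
- move=> /(_ ltac:(itv_lra)).
  have [c ct ->] := MVT ts (pd _ _ t0 (ltW s1)) (pc_sub t0 (ltW s1)).
  have st0 : s - t != 0 by rewrite subr_eq0.
  rewrite mulrCA mulVf// mulr1 => vc.
  move: ct; rewrite in_itv/= => /andP[tc cs].
  exists c; split => //; first itv_lra.
  by move: se; rewrite !ger0_norm; lra.
- move=> /(_ ltac:(itv_lra)).
  have [c ct pE] := MVT ts (pd _ _ (ltW s0) t1) (pc_sub (ltW s0) t1).
  have st0 : s - t != 0 by rewrite subr_eq0.
  have -> : (s - t)^-1 * (p s - p t) = v c.
    by rewrite -[p s - p t]opprB pE; field.
  move=> vc.
  move: ct; rewrite in_itv/= => /andP[sc ct].
  exists c; split => //; first itv_lra.
  by move: se; rewrite !ler0_norm; lra.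
Qed.

(** The interior Lipschitz bound for v is applied to interior times near a and b at which v is close
    to v a and v b. *)
Lemma damped_motion_lipschitz : exists2 K, 0 <= K &
  forall a b, 0 <= a -> a <= b -> b <= T ->
    `|p b - p a| <= K * (b - a) /\ `|v b - v a| <= K * (b - a).
Proof.
have V0 : 0 <= V.
  exact: le_trans (normr_ge0 _) (v_bounded midT).
have rV0 : 0 <= r * V by rewrite mulr_ge0.
set L := B + r * V; have L0 : 0 <= L by rewrite addr_ge0.
have vl a b : 0 <= a -> a <= b -> b <= T -> `|v b - v a| <= L * (b - a).
  move=> a0 ab bT; apply/ler_addgt0Pr => e e0.
  (* Moving both times costs 2 L e' and moving both values costs 2 e', in total e. *)
  pose e' := e / (2 * L + 2).
  have L2 : 0 < 2 * L + 2 by lra.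
  have e'0 : 0 < e' by rewrite divr_gt0.
  have [a' [a'T a'a va]] := v_approx (t := a) ltac:(itv_lra) e'0.
  have [b' [b'T b'b vb]] := v_approx (t := b) ltac:(itv_lra) e'0.
  (* The approximating times may come in the opposite order, hence the absolute value. *)
  have key : `|v b' - v a'| <= L * `|b' - a'|.
    have [/andP[? ?] /andP[? ?]] := (a'T, b'T).
    have [ab'|ab'] := leP a' b'.
      rewrite [X in _ <= L * X]ger0_norm ?subr_ge0//.
      exact: v_lipschitz_interior.
    rewrite distrC [X in _ <= L * X]distrC.
    rewrite [X in _ <= L * X]ger0_norm; last first.
      by rewrite subr_ge0 ltW.
    by apply: v_lipschitz_interior => //; exact: ltW.
  have eE : e = e' * (2 * L + 2) by rewrite /e' divfK// gt_eqF.
  have dab : `|b' - a'| <= (b - a) + 2 * e'.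
    by move: a'a b'b; rewrite !ler_norml => /andP[? ?] /andP[? ?]; lra.
  have : L * `|b' - a'| <= L * ((b - a) + 2 * e') by rewrite ler_wpM2l.
  have -> : v b - v a = (v b' - v a') - (v b' - v b) + (v a' - v a) by ring.
  move=> kk; have k2 := le_trans key kk.
  apply: (le_trans (ler_normD _ _)).
  have := ler_normB (v b' - v a') (v b' - v b).
  rewrite eE; nra.
exists (V + L) => [|a b a0 ab bT]; first by rewrite addr_ge0.
have ba : 0 <= b - a by rewrite subr_ge0.
split; [have := p_lipschitz a0 ab bT|have := vl _ _ a0 ab bT]; nra.
Qed.

End DampedMotion.

(** * The limit of the algorithm *)

Lemma within_continuous_bounded {R : realType} {d : nat} (T : R)
    (Y : R -> 'cV[R]_d) : {within `[0, T], continuous Y} ->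
  exists2 M, 0 <= M & forall t, 0 <= t <= T -> `|Y t| <= M.
Proof.
move=> Yc.
have /compact_bounded := continuous_compact Yc (@segment_compact _ 0 T).
move=> /pinfty_ex_gt0[M M0 YM]; exists M => [|t tT]; first exact: ltW.
by apply: YM; exists t => //=; rewrite in_itv.
Qed.

(** Time 0 is the index 0 of every grid, and the initialization makes the first x-update centred at
    A x0. So [prox_first_step] with eps = [step rho] gives A V = 0, and A is injective. *)
Lemma velocity_at_zero {R : realType} {n m : nat} (f : 'cV[R]_n -> \bar R)
    (g : 'cV[R]_m -> \bar R) (A : 'M[R]_(m, n)) alpha r x0
    (x : R -> nat -> 'cV[R]_n) (z u zh uh : R -> nat -> 'cV[R]_m) V :
  assumption_S1 f g A -> dom f x0 ->
  (forall rho, 0 < rho -> R_HB_ADMM f g A alpha r rho x0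
     (x rho) (z rho) (u rho) (zh rho) (uh rho)) ->
  grid_bigO 0 (fun rho k => (step rho)^-1 *: (x rho k.+1 - x rho k) - V) ->
  V = 0.
Proof.
move=> hS1 dx0 halg hV.
have [fp _ _ _ flsc _ _ _ _ rA _] := hS1.
(* Any positive parameters tending to +oo would do here; the time 1 is an arbitrary choice. *)
pose rho (j : nat) : R := sqr_grid 1 j.
have rho0 j : 0 < rho j := sqr_grid_gt0 ltr01 j.
apply: (full_column_rank_inj rA).
apply: (@prox_first_step _ _ _ f A x0 (fun j => step (rho j))
  (fun j => x (rho j) 1%N)) => //.
- by have [] := fp.
- by move=> j; rewrite step_sqr_grid// divr_gt0.
- exact: cvg_step_sqr_grid.
- move=> j; have H := halg _ (rho0 j).
  have := admm_x H 0%N.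
  rewrite (admm_zh0 H) (admm_z0 H) (admm_uh0 H) (admm_u0 H) subr0.
  by rewrite /step exprVn sqr_sqrtr// ltW.
- apply/subr_cvg0.
  have hV0 := grid_bigO_vanishes hV.
  have gt0 (j : nat) : grid_time (rho j) ((fun _ => 0%N) j) = 0.
    by rewrite /grid_time mulr0.
  have := grid_vanishes_cvg (cvg_sqr_grid ltr01) gt0 hV0.
  by under eq_fun => j do rewrite (admm_x0 (halg _ (rho0 j))).
Qed.

Theorem proposition8 (R : realType) (n m : nat)
    (f : 'cV[R]_n -> \bar R) (g : 'cV[R]_m -> \bar R) (A : 'M[R]_(m, n))
    (hS1 : assumption_S1 f g A) (hS2 : assumption_S2 f g A)
    (alpha r : R) (halpha : 0 < alpha) (hr : 0 < r)
    (x0 : 'cV[R]_n) (hx0 : dom (objective f g A) x0)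
    (x : R -> nat -> 'cV[R]_n) (z u zh uh : R -> nat -> 'cV[R]_m)
    (halg : forall rho : R, 0 < rho ->
      R_HB_ADMM f g A alpha r rho x0
        (x rho) (z rho) (u rho) (zh rho) (uh rho))
    (T : R) (hT : 0 < T)
    (X : R -> 'cV[R]_n) (Z U Zh Uh : R -> 'cV[R]_m)
    (hX : continuous_limit T x X) (hZ : continuous_limit T z Z)
    (hU : continuous_limit T u U) (hZh : continuous_limit T zh Zh)
    (hUh : continuous_limit T uh Uh) :
  heavy_ball_solution f g A alpha r T x0 X.
Proof.
have [Xc Xe [X1 [X2 [dX dX1 fX bX sX]]]] := hX.
have [Zc Ze [Z1 [Z2 [dZ dZ1 fZ bZ sZ]]]] := hZ.
have [Uc Ue [U1 [U2 [dU dU1 fU bU sU]]]] := hU.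
have oc (t : R) : 0 < t < T -> 0 <= t <= T by move=> /andP[/ltW-> /ltW->].
have co (t : R) : 0 < t < T -> 0 <= t < T by move=> /andP[/ltW-> ->].
have oC (t : R) : 0 < t < T -> 0 < t <= T by move=> /andP[-> /ltW->].
(* On the grids [sqr_grid t], time t has index k = [j.+1]; [admm_limit] is applied to the iteration
   from [j.+1] to [j.+2]. *)
have lim (t : R) : 0 < t < T -> [/\ Z t = A *m X t, U t = 0 &
    subdiff (objective f g A) (X t) (A^T *m ((U2 t + r *: U1 t)
      - alpha^-1 *: ((U2 t + r *: U1 t) + (Z2 t + r *: Z1 t))))].
  move=> tT; have /andP[t0 _] := tT.
  have H j := halg _ (sqr_grid_gt0 t0 j).
  apply: (@admm_limit _ _ _ f g A alpha hS1 halpha (sqr_grid t)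
    (fun j => x (sqr_grid t j) j.+2) (fun j => z (sqr_grid t j) j.+2)
    (fun j => u (sqr_grid t j) j.+2) (fun j => zh (sqr_grid t j) j.+1)
    (fun j => uh (sqr_grid t j) j.+1)).
  - by move=> j; exact: sqr_grid_gt0.
  - exact: cvg_sqr_grid.
  - by move=> j; exact: (admm_x (H j)).
  - by move=> j; exact: (admm_z (H j)).
  - by move=> j; exact: (admm_u (H j)).
  - exact: (cvg_grid_next t0 (Xe t (oc t tT)) (fX t (co t tT))).
  - exact: (cvg_grid_next t0 (Ze t (oc t tT)) (fZ t (co t tT))).
  - exact: (cvg_grid_next t0 (Ue t (oc t tT)) (fU t (co t tT))).
  - under eq_fun => j do rewrite (admm_zh (H j)).
    exact: (cvg_grid_acceleration t0 (bZ t (oC t tT)) (sZ t tT)).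
  - under eq_fun => j do rewrite (admm_uh (H j)).
    exact: (cvg_grid_acceleration t0 (bU t (oC t tT)) (sU t tT)).
  - by exists x0.
(* The identities U = 0 and Z = A X on the open interval are now differentiated twice, to express
   the limit subgradient through X alone. *)
have U10 (t : R) : 0 < t < T -> U1 t = 0.
  move=> tT.
  apply: (derivative_on_unique tT (dU t (oc t tT)) (derivative_on_cst0 t)).
  by move=> s /lim[].
have U20 (t : R) : 0 < t < T -> U2 t = 0.
  move=> tT.
  exact: (derivative_on_unique tT (dU1 t tT) (derivative_on_cst0 t)).
have Z1E (t : R) : 0 < t < T -> Z1 t = A *m X1 t.
  move=> tT; apply: (derivative_on_unique tT (dZ t (oc t tT))
    (derivative_on_mulmx (dX t (oc t tT)))).
  by move=> s /lim[].
have Z2E (t : R) : 0 < t < T -> Z2 t = A *m X2 t.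
  move=> tT; exact: (derivative_on_unique tT (dZ1 t tT)
    (derivative_on_mulmx (dX1 t tT))).
have incl (t : R) : 0 < t < T -> subdiff (objective f g A) (X t)
    (- (alpha^-1 *: (A^T *m A *m (X2 t + r *: X1 t)))).
  move=> tT; have [_ _] := lim t tT; rewrite U10// U20// Z1E// Z2E//.
  rewrite scaler0 addr0 !add0r mulmxN; congr (subdiff _ _ (- _)).
  by rewrite -scalemxAr -mulmxA [A *m (_ + _)]mulmxDr -scalemxAr.
have [[fn _] [gn _] _ _ _ _ _ _ _ rA _] := hS1.
have [M M0 XM] := within_continuous_bounded Xc.
(* The growth bound of (S2) controls the subgradient in [incl], since X is bounded on the segment;
   multiplication by alpha and by the inverse of A^T A recovers X'' + r X'. The factor n comes from
   comparing the two norms. *)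
have [B wB] : exists B, forall t, 0 < t < T -> `|X2 t + r *: X1 t| <= B.
  have [c [L [c0 _ cxi _]]] := hS2.
  have [C C0 GC] := mulmx_bounded (invmx (A^T *m A)).
  exists (C * (alpha * (c * (1 + n%:R * M)))) => t tT.
  have wE : X2 t + r *: X1 t = invmx (A^T *m A) *m (- (alpha *:
      - (alpha^-1 *: (A^T *m A *m (X2 t + r *: X1 t))))).
    rewrite scalerN opprK scalerA mulfV ?gt_eqF// scale1r.
    by rewrite (mulKmx (gram_unitmx rA)).
  rewrite wE; apply: (le_trans (GC _)); rewrite ler_wpM2l// normrN normrZ.
  rewrite gtr0_norm// ler_pM2l// (le_trans (norm_le_norm2 _))//.
  apply: (le_trans (cxi _ _ (incl t tT))); rewrite ler_pM2l// lerD2l.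
  by apply: (le_trans (norm2_le_norm _)); rewrite ler_wpM2l// XM// oc.
have lip i : exists2 K, 0 <= K & forall a b, 0 <= a -> a <= b -> b <= T ->
    `|X b i 0 - X a i 0| <= K * (b - a) /\
    `|X1 b i 0 - X1 a i 0| <= K * (b - a).
  apply: (@damped_motion_lipschitz _ T r M B (fun t => X t i 0)
    (fun t => X1 t i 0) (fun t => X2 t i 0)) => //.
  - exact: ltW.
  - move=> s; apply: (cvg_comp _ (fun w : 'cV[R]_n => w i 0) (Xc s)).
    exact: coord_continuous.
  - by move=> t tT; apply: (le_trans (coord_le_norm _ _)); exact: XM.
  - by move=> t tT; exact: (is_derive_derivative_on _ tT (dX t (oc t tT))).
  - by move=> t tT; exact: (is_derive_derivative_on _ tT (dX1 t tT)).
  - move=> t tT; have := coord_le_norm (X2 t + r *: X1 t) i.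
    by rewrite !mxE => /le_trans; apply; exact: wB.
  - by move=> t e tT e0; exact: (derivative_on_coord i (dX t tT) e0).
have [K K0 XK] : exists2 K, 0 <= K & forall a b, 0 <= a -> a <= b -> b <= T ->
    norm2 (X b - X a) <= K * (b - a) /\ norm2 (X1 b - X1 a) <= K * (b - a).
  (* One constant is chosen per coordinate; their sum serves all coordinates at once. *)
  have [K_ K_0 K_P] : exists2 K_ : 'I_n -> R, forall i, 0 <= K_ i &
      forall i a b, 0 <= a -> a <= b -> b <= T ->
        `|X b i 0 - X a i 0| <= K_ i * (b - a) /\
        `|X1 b i 0 - X1 a i 0| <= K_ i * (b - a).
    have [K_ K_P] := choice (fun i => let: ex_intro2 K K0 KP := lip i in
      ex_intro (fun K => 0 <= K /\ _) K (conj K0 KP)).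
    by exists K_ => i; have [] := K_P i.
  exists (n%:R * \sum_i K_ i) => [|a b a0 ab bT].
    by rewrite mulr_ge0//; apply: sumr_ge0.
  have K_le i : K_ i * (b - a) <= (\sum_i K_ i) * (b - a).
    rewrite ler_wpM2r ?subr_ge0// (bigD1 i)//= lerDl.
    by apply: sumr_ge0.
  have S0 : 0 <= (\sum_i K_ i) * (b - a).
    by rewrite mulr_ge0 ?subr_ge0//; apply: sumr_ge0.
  rewrite -mulrA; split; apply: (le_trans (norm2_le_norm _));
    rewrite ler_wpM2l//; apply: norm_le_coord => // i; rewrite !mxE;
    apply: le_trans (K_le i); by have [] := K_P i a b a0 ab bT.
exists X1; split => //.
- split; apply: (@lipschitz_absolutely_continuous _ _ _ K) => a b a0 ab bT;
  by have [] := XK a b a0 ab bT.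
(* The second derivative and the inclusion are available on the open interval, so the two endpoints
   form the null set. *)
- exists [set 0; T]; split.
  + by apply: measurableU; exact: measurable_set1.
  + by apply: countable_lebesgue_measure0; exact: finite_set_countable.
  + move=> t /= notP; apply: contrapT => t0T; apply: notP => /andP[].
    rewrite !le_eqVlt => /predU1P[t0|t0].
      by case: t0T; left; rewrite t0.
    move=> /predU1P[tT|tT]; first by case: t0T; right.
    have {}tT : 0 < t < T by rewrite t0.
    exists (X2 t); first exact: dX1.
    exists (- (alpha^-1 *: (A^T *m A *m (X2 t + r *: X1 t)))); last first.
      by rewrite opprK.
    exact: incl.
(* At time 0 the iterate of index 0 is x0 for every parameter, so its limit X 0 is x0. *)
- have := grid_vanishes_cvg (rho := sqr_grid 1) (k := fun _ => 0%N)
    (cvg_sqr_grid ltr01) (fun j => mulr0 _) (Xe 0 _).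
  rewrite lexx ltW// => /(_ isT) /subr_cvg0.
  under eq_fun => j do rewrite (admm_x0 (halg _ (sqr_grid_gt0 ltr01 j))).
  by move=> xX; apply: (norm_cvg_unique xX); exact: cvg_cst.
- apply: (velocity_at_zero hS1 _ halg); last by apply: fX; rewrite lexx.
  by have [] := dom_objective fn gn hx0.
Qed.
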